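(* For every fixed positive integer $m$, there is an algorithm that, given an instance of the Multiple Drone-Delivery Scheduling Problem (MDSP) with $m$ drones in which every job has cost $c_j=1$, computes an optimal family of assignments (one of maximum total reward among all families of $m$ pairwise disjoint, compatible, feasible assignments) in time polynomial in the number $n$ of jobs.
   Context: MDSP instance: $m$ identical drones, each with energy budget (battery) $B\ge 0$, and $n$ jobs $j=1,\dots,n$. Job $j$ has an open time interval $I_j=(t^L_j,t^R_j)$, an energy cost $c_j$ and a reward $p_j\ge0$. Two jobs conflict if their intervals intersect. An assignment $S_i\subseteq\{1,\dots,n\}$ (the jobs executed by drone $i$) is compatible if no two of its jobs conflict and feasible if $\sum_{j\in S_i}c_j\le B$. The reward of a family $(S_1,\dots,S_m)$ of pairwise disjoint assignments is $\sum_{i=1}^m\sum_{j\in S_i}p_j$; MDSP asks for a family of $m$ pairwise disjoint, compatible, feasible assignments of maximum reward. *)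

(* Defs.v *)
From HB Require Import structures.
From mathcomp Require Import all_boot all_order all_algebra.
Set Implicit Arguments.
Unset Strict Implicit.
Unset Printing Implicit Defensive.
Import Order.TTheory GRing.Theory Num.Theory.
Local Open Scope ring_scope.

(* The number m of drones is a parameter of the problem, not of the record.
   Launch and return times are unconstrained: if tR j <= tL j then the open
   interval of j is empty and j conflicts with no job. *)
Record mdsp (R : realFieldType) (n : nat) := Mdsp {
  battery : R;
  tL : 'I_n -> R;
  tR : 'I_n -> R;
  cost : 'I_n -> R;
  reward : 'I_n -> R;
  battery_ge0 : 0 <= battery;
  reward_ge0 : forall j, 0 <= reward j }.

Section Assignments.
Variables (R : realFieldType) (n : nat) (I : mdsp R n).

Definition job_interval (j : 'I_n) : interval R := `]tL I j, tR I j[.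

Definition conflict (j k : 'I_n) : Prop :=
  exists x : R, x \in job_interval j /\ x \in job_interval k.

Definition compatible (S : {set 'I_n}) : Prop :=
  forall j k, j \in S -> k \in S -> j != k -> ~ conflict j k.

Definition feasible (S : {set 'I_n}) : Prop :=
  \sum_(j in S) cost I j <= battery I.

Definition admissible (m : nat) (S : 'I_m -> {set 'I_n}) : Prop :=
  (forall i k, i != k -> [disjoint S i & S k]) /\
  (forall i, compatible (S i) /\ feasible (S i)).

Definition total_reward (m : nat) (S : 'I_m -> {set 'I_n}) : R :=
  \sum_(i < m) \sum_(j in S i) reward I j.

Definition optimal (m : nat) (S : 'I_m -> {set 'I_n}) : Prop :=
  admissible S /\
  forall T : 'I_m -> {set 'I_n}, admissible T ->
    total_reward T <= total_reward S.

End Assignments.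

(* Algorithms are programs of a random-access machine with unit-cost
   arithmetic.  The memory consists of arrays of natural numbers (used for
   counters and addresses) and arrays of numbers of the ordered field R; a
   program names finitely many of them.  The only arithmetic is addition,
   subtraction (truncated on nat) and comparison, in both sorts: with
   multiplication or rounding at unit cost, polynomial time would be too
   generous.  The syntax does not mention R, so the only field constants
   available to a program are 0 and 1. *)

Inductive nexp : Type :=
  | NConst of nat
  | NGet of nat & nexp
  | NAdd of nexp & nexp
  | NSub of nexp & nexp.

Inductive rexp : Type :=
  | RZero
  | ROne
  | RGet of nat & nexp
  | RAdd of rexp & rexp
  | RSub of rexp & rexp.

Inductive test : Type :=
  | NLe of nexp & nexp
  | RLe of rexp & rexp
  | TNot of test
  | TAnd of test & test.

(* NSet a e v is the assignment a[e] := v, and likewise for RSet. *)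
Inductive com : Type :=
  | Skip
  | NSet of nat & nexp & nexp
  | RSet of nat & nexp & rexp
  | Seq of com & com
  | If of test & com & com
  | While of test & com.

Section Semantics.
Variable R : realFieldType.

(* nats M a k and nums M a k are the k-th cells of the a-th arrays. *)
Record memory := Memory {
  nats : nat -> nat -> nat;
  nums : nat -> nat -> R }.

Fixpoint neval (M : memory) (e : nexp) : nat :=
  match e with
  | NConst k => k
  | NGet a e1 => nats M a (neval M e1)
  | NAdd e1 e2 => (neval M e1 + neval M e2)%N
  | NSub e1 e2 => (neval M e1 - neval M e2)%N
  end.

Fixpoint reval (M : memory) (e : rexp) : R :=
  match e with
  | RZero => 0
  | ROne => 1
  | RGet a e1 => nums M a (neval M e1)
  | RAdd e1 e2 => reval M e1 + reval M e2
  | RSub e1 e2 => reval M e1 - reval M e2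
  end.

Fixpoint teval (M : memory) (b : test) : bool :=
  match b with
  | NLe e1 e2 => (neval M e1 <= neval M e2)%N
  | RLe e1 e2 => reval M e1 <= reval M e2
  | TNot b1 => ~~ teval M b1
  | TAnd b1 b2 => teval M b1 && teval M b2
  end.

Definition update (T : Type) (f : nat -> nat -> T) (a k : nat) (v : T) :=
  fun a' k' => if (a' == a) && (k' == k) then v else f a' k'.

End Semantics.

Fixpoint ncost (e : nexp) : nat :=
  match e with
  | NConst _ => 1
  | NGet _ e1 => (ncost e1).+1
  | NAdd e1 e2 | NSub e1 e2 => (ncost e1 + ncost e2).+1
  end.

Fixpoint rcost (e : rexp) : nat :=
  match e with
  | RZero | ROne => 1
  | RGet _ e1 => (ncost e1).+1
  | RAdd e1 e2 | RSub e1 e2 => (rcost e1 + rcost e2).+1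
  end.

Fixpoint tcost (b : test) : nat :=
  match b with
  | NLe e1 e2 => (ncost e1 + ncost e2).+1
  | RLe e1 e2 => (rcost e1 + rcost e2).+1
  | TNot b1 => (tcost b1).+1
  | TAnd b1 b2 => (tcost b1 + tcost b2).+1
  end.

(* exec c M t M': started in M, the program c halts in M' after t elementary
   operations. *)
Inductive exec (R : realFieldType) :
    com -> memory R -> nat -> memory R -> Prop :=
  | ExecSkip M : exec Skip M 1 M
  | ExecNSet a e v M :
      exec (NSet a e v) M (ncost e + ncost v).+1
        (Memory (update (nats M) a (neval M e) (neval M v)) (nums M))
  | ExecRSet a e v M :
      exec (RSet a e v) M (ncost e + rcost v).+1
        (Memory (nats M) (update (nums M) a (neval M e) (reval M v)))
  | ExecSeq c1 c2 M1 t1 M2 t2 M3 :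
      exec c1 M1 t1 M2 -> exec c2 M2 t2 M3 ->
      exec (Seq c1 c2) M1 (t1 + t2) M3
  | ExecIf b c1 c2 M t M' :
      exec (if teval M b then c1 else c2) M t M' ->
      exec (If b c1 c2) M (tcost b + t) M'
  | ExecWhileStop b c M :
      ~~ teval M b -> exec (While b c) M (tcost b) M
  | ExecWhileStep b c M1 t1 M2 t2 M3 :
      teval M1 b -> exec c M1 t1 M2 -> exec (While b c) M2 t2 M3 ->
      exec (While b c) M1 (tcost b + t1 + t2) M3.

Lemma exec_det (R : realFieldType) c (M : memory R) t1 M1 t2 M2 :
  exec c M t1 M1 -> exec c M t2 M2 -> t1 = t2 /\ M1 = M2.
Proof.
move=> h; elim: h t2 M2 => {c M t1 M1}.
- by move=> M t M' h; inversion h.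
- by move=> a e v M t M' h; inversion h.
- by move=> a e v M t M' h; inversion h.
- move=> c1 c2 M1 t1 M2 t2 M3 _ IH1 _ IH2 t M'.
  inversion 1 as [| | |? ? ? t1' M2' t2' M3' e1 e2| | |]; subst.
  by case: (IH1 _ _ e1) => -> eM; subst; case: (IH2 _ _ e2) => -> ->.
- move=> b c1 c2 M t M' _ IH t' M''.
  inversion 1 as [| | | |? ? ? ? ? ? e1| |]; subst.
  by case: (IH _ _ e1) => -> ->.
- move=> b c M nb t M'.
  inversion 1 as [| | | | | |? ? ? ? ? ? ? hb]; subst => //.
  by rewrite hb in nb.
- move=> b c M1 t1 M2 t2 M3 hb _ IH1 _ IH2 t M'.
  inversion 1 as [| | | | |? ? ? nb|? ? ? t1' M2' t2' M3' _ e1 e2]; subst.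
    by rewrite hb in nb.
  by case: (IH1 _ _ e1) => -> eM; subst; case: (IH2 _ _ e2) => -> ->.
Qed.

Section InputOutput.
Variables (R : realFieldType) (n : nat).

Definition load (f : 'I_n -> R) (k : nat) : R :=
  if insub k is Some j then f j else 0.

(* Number arrays 0 to 4 hold the battery (in cell 0), tL, tR, the costs and
   the rewards; cell 0 of natural-number array 0 holds n; every other cell
   is 0. *)
Definition input (I : mdsp R n) : memory R :=
  Memory
    (fun a k => if (a == 0%N) && (k == 0%N) then n else 0%N)
    (fun a k =>
       match a with
       | 0 => if k == 0%N then battery I else 0
       | 1 => load (tL I) k
       | 2 => load (tR I) k
       | 3 => load (cost I) k
       | 4 => load (reward I) k
       | _ => 0
       end).

(* For each drone i, the first n cells of natural-number array i hold the
   characteristic vector of S i. *)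
Definition outputs (m : nat) (M : memory R) (S : 'I_m -> {set 'I_n}) : Prop :=
  forall (i : 'I_m) (j : 'I_n), nats M i j = (j \in S i) :> nat.

End InputOutput.

(* Main.v *)
(* Order the jobs with the empty intervals first and the others by launch time.
   Along this order "j does not conflict with the later job k" is transitive,
   so a drone may take the next job as soon as that job does not conflict with
   the last one taken.  The last job and the number of jobs of every drone
   are therefore a sufficient state for a dynamic program; there are at most
   (n+1)^(2m) of them.  Since the costs are 1, feasibility bounds the number of
   jobs.

   The running time needs no separate analysis of the algorithm: it is written
   with for-loops whose bounds are cells holding n or n+1 that the program never
   writes, and such a program runs in time polynomial in n. *)

Require Import Defs.
From HB Require Import structures.
From mathcomp Require Import all_boot all_order all_algebra.
From mathcomp Require Import zify.
Set Implicit Arguments.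
Unset Strict Implicit.
Unset Printing Implicit Defensive.
Import Order.TTheory GRing.Theory Num.Theory.
Local Open Scope ring_scope.

(** The restrictions of the machine shape the construction. Array names are constants of the syntax,
    so iteration over drones or over the digits of a state cannot be a loop with a computed index:
    it is expanded in the program text, which is why the program and the degree of its time bound
    depend on [m]. There is no multiplication, so a table index, namely a state and a position read
    in base [n + 1], is computed by Horner's rule with repeated addition. There is neither rounding
    nor a conversion from naturals to the field, so a count is compared with the real battery
    through a table of the field elements 0, 1, ..., [n], built by adding 1. The table of the
    dynamic program stores values and no decisions: the assignment is recovered by a forward walk
    that recomputes the maximisation at each state it meets. *)

(** * For-programs, their compilation and their time bound *)

Inductive prog : Type :=
  | PNop
  | PNat of nat & nexp & nexp
  | PNum of nat & nexp & rexp
  | PSeq of prog & prog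
  | PIf of test & prog & prog
  | PFor of nat & nat & prog.

Notation var a := (NGet a (NConst 0)).

Fixpoint compile (p : prog) : com :=
  match p with
  | PNop => Skip
  | PNat a e v => NSet a e v
  | PNum a e v => RSet a e v
  | PSeq p1 p2 => Seq (compile p1) (compile p2)
  | PIf b p1 p2 => If b (compile p1) (compile p2)
  | PFor x b p1 =>
      Seq (NSet x (NConst 0) (NConst 0))
          (While (NLe (NAdd (var x) (NConst 1)) (var b))
             (Seq (compile p1)
                (NSet x (NConst 0) (NAdd (var x) (NConst 1)))))
  end.

Fixpoint nwrites (p : prog) (a : nat) : bool :=
  match p with
  | PNop | PNum _ _ _ => false
  | PNat a' _ _ => a == a'
  | PSeq p1 p2 | PIf _ p1 p2 => nwrites p1 a || nwrites p2 a
  | PFor x _ p1 => (a == x) || nwrites p1 a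
  end.

Fixpoint rwrites (p : prog) (a : nat) : bool :=
  match p with
  | PNop | PNat _ _ _ => false
  | PNum a' _ _ => a == a'
  | PSeq p1 p2 | PIf _ p1 p2 => rwrites p1 a || rwrites p2 a
  | PFor _ _ p1 => rwrites p1 a
  end.

(* The arrays in bs hold the loop bounds; since they are never written, the
   nesting depth alone makes the running time polynomial. *)
Fixpoint wf (bs : seq nat) (p : prog) : bool :=
  match p with
  | PNop | PNum _ _ _ => true
  | PNat a _ _ => a \notin bs
  | PSeq p1 p2 | PIf _ p1 p2 => wf bs p1 && wf bs p2
  | PFor x b p1 => [&& x \notin bs, b \in bs, ~~ nwrites p1 x & wf bs p1]
  end.

(** In a compiled for-loop the initialisation costs 3, a test 7 and an increment 6. Hence 10 for the
    initialisation and the final failing test, and 13 plus the body for each of at most [n + 1]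
    rounds. A conditional is charged for both branches, which avoids a maximum of polynomials. *)
Fixpoint time_poly (p : prog) : {poly nat} :=
  match p with
  | PNop => 1
  | PNat a e v => ((ncost e + ncost v).+1)%:P
  | PNum a e v => ((ncost e + rcost v).+1)%:P
  | PSeq p1 p2 => time_poly p1 + time_poly p2
  | PIf b p1 p2 => (tcost b)%:P + time_poly p1 + time_poly p2
  | PFor _ _ p1 => 10%N%:P + ('X + 1) * (13%N%:P + time_poly p1)
  end.

Section Run.
Variable R : realFieldType.
Implicit Types (M : memory R) (p : prog).

Definition setn M a k v := Memory (update (nats M) a k v) (nums M).
Definition setr M a k v := Memory (nats M) (update (nums M) a k v).

(** The number of rounds of a for-loop is read once, at its start, while the compiled [While]
    rereads the bound before each round. The two agree under [wf], where neither the counter nor the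
    body touches the bound. *)
Fixpoint run p M : memory R :=
  match p with
  | PNop => M
  | PNat a e v => setn M a (neval M e) (neval M v)
  | PNum a e v => setr M a (neval M e) (reval M v)
  | PSeq p1 p2 => run p2 (run p1 M)
  | PIf b p1 p2 => if teval M b then run p1 M else run p2 M
  | PFor x b p1 =>
      iter (nats M b 0)
        (fun M1 => setn (run p1 M1) x 0 (nats (run p1 M1) x 0 + 1))
        (setn M x 0 0)
  end.

Lemma nats_setn M a k v a' k' :
  nats (setn M a k v) a' k' = if (a' == a) && (k' == k) then v else nats M a' k'.
Proof. by []. Qed.

Lemma nums_setr M a k v a' k' :
  nums (setr M a k v) a' k' = if (a' == a) && (k' == k) then v else nums M a' k'.
Proof. by []. Qed.

Lemma nats_run p M a k : ~~ nwrites p a -> nats (run p M) a k = nats M a k.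
Proof.
elim: p M => //=.
- by move=> a' e v M; rewrite /update => /negPf->.
- by move=> p1 IH1 p2 IH2 M; rewrite negb_or => /andP[h1 h2]; rewrite IH2 ?IH1.
- move=> b p1 IH1 p2 IH2 M; rewrite negb_or => /andP[h1 h2].
  by case: ifP => _; [rewrite IH1 | rewrite IH2].
- move=> x b p1 IH M; rewrite negb_or => /andP[/negPf hx h1].
  elim: (nats M b 0) => [|i IHi] /=; first by rewrite /update hx.
  by rewrite /update hx /= IH.
Qed.

Lemma nums_run p M a k : ~~ rwrites p a -> nums (run p M) a k = nums M a k.
Proof.
elim: p M => //=.
- by move=> a' e v M; rewrite /update => /negPf->.
- by move=> p1 IH1 p2 IH2 M; rewrite negb_or => /andP[h1 h2]; rewrite IH2 ?IH1.
- move=> b p1 IH1 p2 IH2 M; rewrite negb_or => /andP[h1 h2].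
  by case: ifP => _; [rewrite IH1 | rewrite IH2].
- move=> x b p1 IH M h1.
  by elim: (nats M b 0) => [|i IHi] //=; rewrite IH.
Qed.

Lemma run_for (P : nat -> memory R -> Prop) x b p M :
  ~~ nwrites p x ->
  P 0%N (setn M x 0 0) ->
  (forall i M1, (i < nats M b 0)%N -> nats M1 x 0 = i -> P i M1 ->
     P i.+1 (setn (run p M1) x 0 i.+1)) ->
  P (nats M b 0) (run (PFor x b p) M).
Proof.
move=> hx h0 hS /=; set f := fun M1 => _.
suff: forall i, (i <= nats M b 0)%N ->
    P i (iter i f (setn M x 0 0)) /\ nats (iter i f (setn M x 0 0)) x 0 = i.
  by move=> /(_ _ (leqnn _)) [].
elim=> [|i IH] hi; first by rewrite /= /update !eqxx.
have [h1 h2] := IH (ltnW hi).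
rewrite iterS {1 3}/f nats_run // h2 addn1; split; first exact: hS.
by rewrite nats_setn !eqxx.
Qed.

Lemma wf_nwrites bs p b : wf bs p -> b \in bs -> ~~ nwrites p b.
Proof.
move=> + hb; elim: p => //=.
- by move=> a _ _; apply: contra => /eqP<-.
- by move=> p1 IH1 p2 IH2 /andP[/IH1 h1 /IH2 h2]; rewrite negb_or h1.
- by move=> _ p1 IH1 p2 IH2 /andP[/IH1 h1 /IH2 h2]; rewrite negb_or h1.
- move=> x b' p1 IH /and4P[hx _ _ /IH h1]; rewrite negb_or h1 andbT.
  by apply: contra hx => /eqP<-.
Qed.

Lemma exec_compile bs n p M :
  wf bs p -> (forall b, b \in bs -> (nats M b 0 <= n.+1)%N) ->
  exists2 t, exec (compile p) M t (run p M) & (t <= (time_poly p).[n])%N.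
Proof.
elim: p M => /=.
- by move=> M _ _; exists 1%N; [constructor | rewrite hornerE].
- by move=> a e v M _ _; exists (ncost e + ncost v).+1;
    [constructor | rewrite hornerE].
- by move=> a e v M _ _; exists (ncost e + rcost v).+1;
    [constructor | rewrite hornerE].
- move=> p1 IH1 p2 IH2 M /andP[w1 w2] hM.
  have [t1 e1 l1] := IH1 M w1 hM.
  have [|t2 e2 l2] := IH2 (run p1 M) w2.
    by move=> b hb; rewrite nats_run ?hM // (wf_nwrites w1).
  exists (t1 + t2)%N; first exact: ExecSeq e1 e2.
  by rewrite hornerD leq_add.
- move=> b p1 IH1 p2 IH2 M /andP[w1 w2] hM.
  have [t1 e1 l1] := IH1 M w1 hM; have [t2 e2 l2] := IH2 M w2 hM.
  exists (tcost b + (if teval M b then t1 else t2))%N.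
    by apply: ExecIf; case: ifP.
  have -> : ((tcost b)%:P + time_poly p1 + time_poly p2).[n] =
      (tcost b + (time_poly p1).[n] + (time_poly p2).[n])%N by rewrite !hornerE.
  by case: ifP => _; lia.
- move=> x b p1 IH M /and4P[hx hb hp w1] hM.
  set f := fun M1 => _; set M0 := setn M x 0 0.
  set T := (time_poly p1).[n].
  set W := While _ _.
  have xb b' : b' \in bs -> (b' == x) = false.
    by move=> hb'; apply/negP => /eqP e; rewrite -e hb' in hx.
  have inv i : [/\ nats (iter i f M0) x 0 = i
      & forall b', b' \in bs -> nats (iter i f M0) b' 0 = nats M b' 0].
    elim: i => [|i [h1 h2]].
      by split=> [|b' hb']; rewrite /= /update ?eqxx // (xb _ hb').
    split=> [|b' hb'].
      by rewrite iterS {1}/f nats_setn !eqxx nats_run // h1 addn1.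
    rewrite iterS {1}/f nats_setn (xb _ hb') /= nats_run ?h2 //.
    exact: wf_nwrites w1 hb'.
  (* Induction on the number [k] of rounds still to run, after [i] rounds: a derivation for [While]
     is assembled from its last test backwards. *)
  have loop k : forall i, (i + k = nats M b 0)%N ->
      exists2 t, exec W (iter i f M0) t (iter (nats M b 0) f M0)
               & (t <= 7 + k * (13 + T))%N.
    elim: k => [|k IHk] i hi.
      exists 7%N; last by [].
      rewrite -hi addn0; apply: ExecWhileStop => /=.
      by have [-> h2] := inv i; rewrite h2 // -hi addn0 addn1 ltnn.
    have [h1 h2] := inv i.
    have [|t1 e1 l1] := IH (iter i f M0) w1.
      by move=> b' hb'; rewrite h2 // hM.
    have [|t2 e2 l2] := IHk i.+1; first by rewrite addSnnS.
    exists (7 + (t1 + 6) + t2)%N; last first.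
      rewrite mulSn; move: l1 l2; rewrite -/T; move: (muln _ _) => z.
      by lia.
    apply: ExecWhileStep e2; first by rewrite /= h1 h2 // -hi; lia.
    by apply: ExecSeq e1 _; apply: ExecNSet.
  have [//|t et lt] := loop (nats M b 0) 0%N.
  exists (3 + t)%N; first by apply: ExecSeq et; apply: ExecNSet.
  have -> : (10%N%:P + ('X + 1) * (13%N%:P + time_poly p1)).[n] =
      (10 + n.+1 * (13 + T))%N by rewrite !hornerE -[n + 1]/(addn n 1) addn1.
  have hN : (nats M b 0 * (13 + T) <= n.+1 * (13 + T))%N by rewrite leq_mul2r hM ?orbT.
  by move: lt hN; move: (muln _ _) (muln _ _) => u v; lia.
Qed.

Fixpoint unroll (f : nat -> prog) (k : nat) : prog :=
  if k is k1.+1 then PSeq (unroll f k1) (f k1) else PNop.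

Lemma nwrites_unroll f k a :
  nwrites (unroll f k) a -> exists2 i, (i < k)%N & nwrites (f i) a.
Proof.
elim: k => //= k IH /orP[/IH[i ik h] | h]; last by exists k.
by exists i; rewrite // ltnW.
Qed.

Lemma rwrites_unroll f k a :
  rwrites (unroll f k) a -> exists2 i, (i < k)%N & rwrites (f i) a.
Proof.
elim: k => //= k IH /orP[/IH[i ik h] | h]; last by exists k.
by exists i; rewrite // ltnW.
Qed.

Lemma wf_unroll bs f k :
  (forall i, (i < k)%N -> wf bs (f i)) -> wf bs (unroll f k).
Proof. by elim: k => //= k IH h; rewrite h // IH // => i hi; exact/h/ltnW. Qed.

End Run.

(** * The dynamic program as a recursion on abstract positions *)

Section DynamicProgram.
Variables (R : realFieldType) (m n : nat) (bat : R).
Variables (follows : nat -> nat -> bool) (p : nat -> R).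
Implicit Types (v w : nat -> nat) (c : nat -> nat) (r i d : nat).

(* For i < m, digit i of a state is 0 or one more than the last position given
   to drone i, and digit m + i is the number of positions given to drone i. *)
Definition place v i r d : nat :=
  if d == i then r.+1 else if d == (m + i)%N then (v d).+1 else v d.

Definition move v i r := if (i < m)%N then place v i r else v.

Definition allowed r v i : bool :=
  ((v (m + i)%N).+1%:R <= bat) && follows (v i) r.

(** States are functions on all naturals, but only these digits enter a table index, so this
    relation takes the place of equality of states. *)
Definition same v w := forall d, (d < m + m)%N -> v d = w d.

(* With F the optimum from position r + 1 on, this is the optimum from position
   r on when only drones below k may receive r; the second component is the
   drone that does, or m if none. *)
Fixpoint best (F : (nat -> nat) -> R) r v k : R * nat :=
  if k is i.+1 then
    let b := best F r v i in
    let x := F (place v i r) + p r in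
    if allowed r v i && (b.1 < x) then (x, i) else b
  else (F v, m).

(** The argument counts the positions still to come, which makes the backward recursion structural;
    the position being decided is [n - k]. *)
Fixpoint value k v : R :=
  if k is k1.+1 then (best (value k1) (n - k) v m).1 else 0.

Lemma allowed_same r v w i :
  (i < m)%N -> same v w -> allowed r v i = allowed r w i.
Proof. by move=> hi h; rewrite /allowed !h //; lia. Qed.

Lemma place_same v w i r : same v w -> same (place v i r) (place w i r).
Proof. by move=> h d hd; rewrite /place h. Qed.

Lemma best_same F r v w k :
  (forall v1 w1, same v1 w1 -> F v1 = F w1) -> (k <= m)%N -> same v w ->
  best F r v k = best F r w k.
Proof.
move=> hF + h; elim: k => [|k IH] hk /=; first by rewrite (hF _ _ h).
rewrite IH ?(ltnW hk) // (allowed_same _ hk h).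
by rewrite (hF _ _ (place_same k r h)).
Qed.

Lemma value_same k v w : same v w -> value k v = value k w.
Proof. by elim: k v w => //= k IH v w h; rewrite (best_same _ IH (leqnn m) h). Qed.

Lemma best_ge F r v k : F v <= (best F r v k).1.
Proof.
elim: k => //= k IH; case: ifP => //= /andP[_ /ltW]; exact: le_trans.
Qed.

Lemma best_ge_place F r v k i :
  (i < k)%N -> allowed r v i -> F (place v i r) + p r <= (best F r v k).1.
Proof.
elim: k => //= k IH; rewrite ltnS leq_eqVlt => /orP[/eqP-> | hi] a.
  by rewrite a /=; case: ltP.
by case: ifP => [/andP[_ /ltW] /= | _]; [apply: le_trans|]; exact: IH.
Qed.

Lemma bestP F r v k (b := best F r v k) : (k <= m)%N ->
  (b.2 = m /\ b.1 = F v) \/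
  [/\ (b.2 < m)%N, allowed r v b.2 & b.1 = F (place v b.2 r) + p r].
Proof.
rewrite {}/b; elim: k => [|k IH] hk /=; first by left.
by case: ifP => [/andP[a _] | _]; [right | exact/IH/ltnW].
Qed.

(** A choice [c] maps a position to its drone, any value from [m] on meaning that no drone takes it.
    This is the state reached just before position [r]. *)
Fixpoint trace c r : nat -> nat :=
  if r is r1.+1 then move (trace c r1) (c r1) r1 else fun=> 0%N.

Definition legal c :=
  forall r, (r < n)%N -> (c r < m)%N -> allowed r (trace c r) (c r).

Lemma trace_le c r d : (d < m + m)%N -> (trace c r d <= r)%N.
Proof.
move=> hd; elim: r => //= r IH; rewrite /move /place.
by case: ifP => _; last exact: leqW; case: ifP => // _; case: ifP => // _; exact: leqW.
Qed.

(** Induction on the positions left: legality says exactly that the move made by [c] is among the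
    alternatives over which [best] maximises. *)
Lemma value_ge c k : (k <= n)%N -> legal c ->
  \sum_(n - k <= r < n | (c r < m)%N) p r <= value k (trace c (n - k)).
Proof.
move=> + hc; elim: k => [|k IH] hk /=; first by rewrite subn0 big_geq.
rewrite big_ltn_cond; last by lia.
have {IH} := IH (ltnW hk); have -> : (n - k)%N = (n - k.+1).+1 by lia.
move=> IH; case: ifP => hm; last first.
  by apply: le_trans IH _ => /=; rewrite /move hm; exact: best_ge.
rewrite addrC; apply: le_trans (lerD IH (lexx _)) _ => /=; rewrite /move hm.
by apply: best_ge_place; rewrite ?hc //; lia.
Qed.

Fixpoint greedy_state r : nat -> nat :=
  if r is r1.+1 then
    move (greedy_state r1)
      (best (value (n - r)) r1 (greedy_state r1) m).2 r1
  else fun=> 0%N.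

Definition greedy r : nat := (best (value (n - r.+1)) r (greedy_state r) m).2.

Lemma trace_greedy r : trace greedy r = greedy_state r.
Proof. by elim: r => //= r ->. Qed.

Lemma greedy_legal : legal greedy.
Proof.
move=> r hr hm; rewrite trace_greedy /greedy in hm *.
case: (bestP (value (n - r.+1)) r (greedy_state r) (leqnn m)) => [[e _] | []] //.
by rewrite e ltnn in hm.
Qed.

(** The drone recorded by [best] attains the value recorded with it, so nothing is lost at any
    position. *)
Lemma value_greedy k : (k <= n)%N ->
  \sum_(n - k <= r < n | (greedy r < m)%N) p r = value k (greedy_state (n - k)).
Proof.
elim: k => [|k IH] hk /=; first by rewrite subn0 big_geq.
rewrite big_ltn_cond; last by lia.
have := IH (ltnW hk); have -> : (n - k)%N = (n - k.+1).+1 by lia.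
move=> -> /=; rewrite -/(greedy _).
have e : greedy (n - k.+1) = (best (value k) (n - k.+1) (greedy_state (n - k.+1)) m).2.
  by rewrite /greedy (_ : n - (n - k.+1).+1 = k)%N //; lia.
rewrite /move.
case: (bestP (value k) (n - k.+1) (greedy_state (n - k.+1)) (leqnn m)); rewrite -e.
  by move=> [-> ->]; rewrite ltnn.
by move=> [h1 _ ->]; rewrite h1 addrC.
Qed.

Lemma greedy_max c : legal c ->
  \sum_(0 <= r < n | (c r < m)%N) p r <= \sum_(0 <= r < n | (greedy r < m)%N) p r.
Proof.
move=> hc; have := value_ge (leqnn n) hc; have := value_greedy (leqnn n).
by rewrite subnn /= => ->.
Qed.

Lemma trace_count c r i : (i < m)%N ->
  trace c r (m + i) = (\sum_(0 <= k < r) (c k == i))%N.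
Proof.
move=> hi; elim: r => [|r IH] /=; first by rewrite big_geq.
rewrite big_nat_recr //= -IH /move /place.
case: ifP => [h | /negP h].
  have -> : (m + i == c r)%N = false by lia.
  rewrite eqn_add2l eq_sym; case: eqP => _; rewrite /= ?addn1 ?addn0 //.
by have -> : (c r == i) = false by [lia]; rewrite addn0.
Qed.

Lemma trace_lastP c r i : (i < m)%N ->
  (trace c r i = 0%N /\ forall k, (k < r)%N -> c k != i) \/
  exists l, [/\ trace c r i = l.+1, (l < r)%N, c l = i &
             forall k, (l < k < r)%N -> c k != i].
Proof.
move=> hi; elim: r => [|r IH] /=; first by left.
have [e|ne] := eqVneq (c r) i.
  right; exists r; split=> //; last by lia.
  by rewrite e /move hi /place eqxx.
have -> : move (trace c r) (c r) r i = trace c r i.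
  rewrite /move /place; case: ifP => // _.
  by rewrite eq_sym (negPf ne) (_ : (i == m + c r)%N = false) //; lia.
case: IH => [[e h] | [l [e lr cl h]]]; [left | right; exists l]; split => //.
- by move=> k; rewrite ltnS leq_eqVlt => /orP[/eqP-> | /h].
- exact: ltnW.
- move=> k /andP[lk]; rewrite ltnS leq_eqVlt => /orP[/eqP-> // | kr].
  by apply: h; rewrite lk.
Qed.

(** Legality compares a position only with the last one of the same drone; strong induction on [r]
    and transitivity extend this to all earlier ones. *)
Lemma legal_follows c l r :
  (forall l k r, (l < k < r)%N -> (r < n)%N ->
     follows l.+1 k -> follows k.+1 r -> follows l.+1 r) ->
  legal c -> (l < r < n)%N -> (c r < m)%N -> c l = c r -> follows l.+1 r.
Proof.
move=> ftrans hc; elim/ltn_ind: r => r IH /andP[lr rn] cm clr.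
have /andP[_ f] := hc r rn cm.
case: (trace_lastP c r cm) => [[_ /(_ l lr)] | [k [e kr ck h]]].
  by rewrite clr eqxx.
rewrite e in f; case: (ltngtP l k) => [lk | kl | -> //].
- apply: (ftrans l k r) => //; first by rewrite lk.
  by apply: IH; rewrite ?ck // lk (ltn_trans kr).
- by have := h l; rewrite kl lr clr eqxx => /(_ isT).
Qed.

(** The check made when drone [i] takes a position bounds its count after that move, and other
    positions leave the count unchanged. A drone without positions is covered by [0 <= bat]. *)
Lemma legal_count c i : 0 <= bat -> legal c -> (i < m)%N ->
  (\sum_(0 <= k < n) (c k == i))%N%:R <= bat.
Proof.
move=> hb hc hi; suff: forall r, (r <= n)%N ->
    (\sum_(0 <= k < r) (c k == i))%N%:R <= bat by apply.
elim=> [|r IH] hr; first by rewrite big_geq.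
rewrite big_nat_recr //=; case: eqP => [e|_]; last by rewrite addn0 IH // ltnW.
have cm : (c r < m)%N by rewrite e.
by have /andP[+ _] := hc r hr cm; rewrite e trace_count // addn1.
Qed.

(** Makes every admissible family a competitor of [greedy]. The check at [r] concerns a prefix count
    plus one, which is at most the total count because [r] itself goes to this drone. *)
Lemma legalI c :
  (forall r, (r < n)%N -> follows 0 r) ->
  (forall l r, (l < r < n)%N -> (c r < m)%N -> c l = c r -> follows l.+1 r) ->
  (forall i, (i < m)%N -> (\sum_(0 <= k < n) (c k == i))%N%:R <= bat) ->
  legal c.
Proof.
move=> f0 fc hc r rn cm; apply/andP; split; last first.
  case: (trace_lastP c r cm) => [[-> _] | [l [-> lr cl _]]]; first exact: f0.
  by apply: fc; rewrite // lr.
apply: le_trans (hc _ cm); rewrite ler_nat trace_count //.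
rewrite (@big_cat_nat _ _ _ r 0%N n) ?(ltnW rn) //=.
by rewrite (big_ltn rn) eqxx -addn1 leq_add2l; exact: leq_addr.
Qed.

End DynamicProgram.

(** * The order on jobs and its ranks *)

Section JobOrder.
Variables (R : realFieldType) (n : nat) (tl tr : nat -> R).
Implicit Types j k l : nat.

Definition empty j := tr j <= tl j.

Definition prec k j :=
  (empty k && (~~ empty j || (k < j)%N)) ||
  (~~ empty k && ~~ empty j &&
     ((tl k < tl j) || (tl k <= tl j) && (k < j)%N)).

(** Absence of conflict when [k] precedes [j]: if [k] is nonempty then so is [j], and [j] does not
    launch before [k]. *)
Definition apart k j := empty k || (tr k <= tl j).

(** Counting predecessors sorts with two nested for-loops and without exchanging entries. The
    tie-breaking by index in [prec] makes the ranks distinct. *)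
Definition rank j := (\sum_(0 <= k < n) prec k j)%N.

Lemma prec_irr j : ~~ prec j j.
Proof. by rewrite /prec ltnn !ltxx lexx; case: empty. Qed.

Lemma prec_total j k : j != k -> prec j k || prec k j.
Proof.
rewrite /prec; case: (empty j); case: (empty k) => //=; rewrite ?orbF.
  by case: ltngtP.
by case: ltgtP => //; case: ltngtP.
Qed.

Lemma prec_trans j k l : prec j k -> prec k l -> prec j l.
Proof.
rewrite /prec; case: (empty j); case: (empty k); case: (empty l) => //=.
  by rewrite !orbF; exact: ltn_trans.
move=> /orP[a | /andP[a a']] /orP[b | /andP[b b']]; apply/orP.
- by left; exact: lt_trans b.
- by left; exact: lt_le_trans b.
- by left; exact: le_lt_trans b.
- by right; rewrite (le_trans a b) (ltn_trans a' b').
Qed.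

(** A nonempty [j] precedes only nonempty jobs, so [tr j <= tl k < tr k <= tl l]. An empty [k] in
    the middle would break this chain, which is why empty intervals are placed first. *)
Lemma apart_trans j k l : prec j k -> apart j k -> apart k l -> apart j l.
Proof.
rewrite /apart /prec; case: (empty j) => //=.
case ek: (empty k) => //= _ h1 h2; apply: le_trans h1 (le_trans _ h2).
by apply: ltW; rewrite ltNge -/(empty k) ek.
Qed.

Lemma rankE (j : nat) : rank j = #|[set i : 'I_n | prec i j]|.
Proof. by rewrite /rank big_mkord -sum1dep_card [RHS]big_mkcond. Qed.

Lemma rank_lt j k : (j < n)%N -> prec j k -> (rank j < rank k)%N.
Proof.
move=> jn jk; rewrite !rankE; apply/proper_card/properP; split.
  by apply/subsetP => i; rewrite !inE => /prec_trans; exact.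
by exists (Ordinal jn); rewrite !inE //= prec_irr.
Qed.

Lemma rank_ltn j : (j < n)%N -> (rank j < n)%N.
Proof.
move=> jn; rewrite rankE -[X in (_ < X)%N]card_ord -cardsT.
apply/proper_card/properP; split; first exact/subsetP.
by exists (Ordinal jn); rewrite !inE //= prec_irr.
Qed.

Lemma prec_rank j k : (j < n)%N -> (k < n)%N -> (rank j < rank k)%N -> prec j k.
Proof.
move=> jn kn h; have [e|/prec_total /orP[]//] := eqVneq j k.
  by rewrite e ltnn in h.
by move=> /(rank_lt kn) h'; rewrite ltnNge (ltnW h') in h.
Qed.

Definition rank_ord (j : 'I_n) : 'I_n := Ordinal (rank_ltn (ltn_ord j)).

Lemma rank_inj j k : (j < n)%N -> (k < n)%N -> rank j = rank k -> j = k.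
Proof.
move=> jn kn e; apply/eqP/negPn/negP => /prec_total /orP[] h.
  by have := rank_lt jn h; rewrite e ltnn.
by have := rank_lt kn h; rewrite e ltnn.
Qed.

Lemma rank_ord_inj : injective rank_ord.
Proof. by move=> j k [/(rank_inj (ltn_ord j) (ltn_ord k)) /val_inj]. Qed.

End JobOrder.

Lemma load_ord (R : realFieldType) n (f : 'I_n -> R) (j : 'I_n) : load f j = f j.
Proof. by rewrite /load valK. Qed.

Lemma load_out (R : realFieldType) n (f : 'I_n -> R) : load f n = 0.
Proof. by rewrite /load insubF // ltnn. Qed.

(** * Legal choices correspond to admissible families *)

Section Instance.
Variables (R : realFieldType) (m n : nat) (I : mdsp R n).
Hypothesis unit_cost : forall j, cost I j = 1.
Let tl := load (tL I).
Let tr := load (tR I).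

(* Position r of the job order holds job ord r.+1.  The dummy job ord 0 = n,
   whose interval is ]0, 0[, conflicts with nothing and stands for "no
   previous job". *)
Variable ord : nat -> nat.
Hypothesis ord0 : ord 0 = n.
Hypothesis ord_rank : forall j, (j < n)%N -> ord (rank n tl tr j).+1 = j.
Let rk (j : 'I_n) : nat := rank n tl tr j.

Definition follows l r := apart (load (tL I)) (load (tR I)) (ord l) (ord r.+1).

Definition gain r := load (reward I) (ord r.+1).

Lemma conflictP (j k : 'I_n) : prec tl tr j k -> conflict I j k <-> ~~ apart tl tr j k.
Proof.
move=> jk; split=> [[x []]|].
  rewrite /job_interval !in_itv /= -!(load_ord (tL I)) -!(load_ord (tR I)).
  move=> /andP[a b] /andP[c d]; rewrite /apart negb_or /empty -!ltNge.
  by rewrite (lt_trans a b) (lt_trans c b).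
rewrite /apart negb_or => /andP[ej h].
move: jk; rewrite /prec (negPf ej) /= => /andP[ek hjk].
have {}hjk : tl j <= tl k by case/orP: hjk => [/ltW | /andP[]].
(* Since [k] does not launch before [j], the two intervals meet in the one from [tl k] to the
   smaller return time; its midpoint is the common point. *)
have h2 : tl k < Num.min (tr j) (tr k).
  by rewrite lt_min !ltNge h.
have [a b] := midf_lt h2; move: b; rewrite lt_min => /andP[b c].
exists ((tl k + Num.min (tr j) (tr k)) / 2).
rewrite /job_interval !in_itv /= -!(load_ord (tL I)) -!(load_ord (tR I)).
by rewrite a b c (le_lt_trans hjk a).
Qed.

Lemma conflict_sym (j k : 'I_n) : conflict I j k -> conflict I k j.
Proof. by case=> x [a b]; exists x. Qed.

Lemma rk_surj r : (r < n)%N -> exists j : 'I_n, rk j = r.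
Proof.
move=> rn; have [g _ gK] := injF_bij (@rank_ord_inj R n tl tr).
by exists (g (Ordinal rn)); rewrite /rk; have /(congr1 val) := gK (Ordinal rn).
Qed.

Lemma ord_rk (j : 'I_n) : ord (rk j).+1 = j.
Proof. exact: ord_rank. Qed.

Lemma rk_prec (j k : 'I_n) : (rk j < rk k)%N = prec tl tr j k.
Proof.
by apply/idP/idP; [apply: prec_rank | apply: rank_lt].
Qed.

Lemma sum_rk (T : nmodType) (f : nat -> T) :
  \sum_(0 <= r < n) f r = \sum_(j < n) f (rk j).
Proof. by rewrite big_mkord (reindex_inj (@rank_ord_inj R n tl tr)). Qed.

Lemma follows0 r : follows 0 r.
Proof. by rewrite /follows ord0 /apart /empty !load_out lexx. Qed.

Lemma follows_trans l k r : (l < k < r)%N -> (r < n)%N ->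
  follows l.+1 k -> follows k.+1 r -> follows l.+1 r.
Proof.
move=> /andP[lk kr] rn.
have [j3 e3] := rk_surj rn; have [j2 e2] := rk_surj (ltn_trans kr rn).
have [j1 e1] := rk_surj (ltn_trans lk (ltn_trans kr rn)).
move: lk kr; rewrite -e1 -e2 -e3 /follows !ord_rk => lk kr.
by apply: apart_trans; rewrite -rk_prec.
Qed.

Lemma follows_rk (j k : 'I_n) :
  (rk j < rk k)%N -> follows (rk j).+1 (rk k) <-> ~ conflict I j k.
Proof.
rewrite rk_prec => jk; rewrite /follows !ord_rk; split=> [h /(conflictP jk)|].
  by rewrite h.
by move=> h; apply/negPn/negP => /(conflictP jk).
Qed.

Definition part (c : nat -> nat) (i : 'I_m) : {set 'I_n} :=
  [set j : 'I_n | c (rk j) == i].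

Lemma card_part c i : #|part c i| = (\sum_(0 <= r < n) (c r == i))%N.
Proof. by rewrite sum_rk -sum1dep_card big_mkcond. Qed.

Lemma feasibleE S : feasible I S = (#|S|%:R <= battery I).
Proof.
by rewrite /feasible (eq_bigr (fun=> 1)) => [|j _]; rewrite ?unit_cost // sumr_const.
Qed.

Lemma total_reward_part c :
  total_reward I (part c) = \sum_(0 <= r < n | (c r < m)%N) gain r.
Proof.
rewrite [RHS]big_mkcond sum_rk /total_reward (exchange_big_dep xpredT) //=.
apply: eq_bigr => j _; rewrite /gain ord_rk load_ord.
rewrite (eq_bigl (fun i : 'I_m => c (rk j) == i)) => [|i]; last by rewrite inE.
case: ifP => [h | /negbT h].
  by rewrite (big_pred1 (Ordinal h)).
rewrite big_pred0 // => i; apply/negP => /eqP e.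
by rewrite e ltn_ord in h.
Qed.

Lemma legal_admissible c : legal m n (battery I) follows c -> admissible I (part c).
Proof.
move=> hc; split=> [i k ik|i].
  rewrite -setI_eq0; apply/eqP/setP => j; rewrite !inE.
  apply/negP => /andP[/eqP-> e]; by rewrite -val_eqE e in ik.
split; last first.
  by rewrite feasibleE card_part; apply: legal_count hc _; rewrite ?battery_ge0.
have main (j k : 'I_n) : c (rk j) = i -> c (rk k) = i ->
    (rk j < rk k)%N -> ~ conflict I j k.
  move=> cj ck jk; apply/(follows_rk jk); apply: (legal_follows _ hc).
  - exact: follows_trans.
  - by rewrite jk rank_ltn.
  - by rewrite ck.
  - by rewrite cj ck.
move=> j k; rewrite !inE => /eqP cj /eqP ck /(prec_total tl tr).
rewrite -!rk_prec => /orP[] h; first exact: main.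
by move=> /conflict_sym; exact: main.
Qed.

Lemma admissible_legal (T : 'I_m -> {set 'I_n}) : admissible I T ->
  exists2 c, legal m n (battery I) follows c & T =1 part c.
Proof.
case=> dT hT.
(* The drone holding the job of rank [r] is unique by disjointness of [T]; the default [m] marks a
   job that no drone executes. *)
pose c r : nat := if [pick i | [exists j : 'I_n, (rk j == r) && (j \in T i)]] is Some i
                  then i else m.
have hc : T =1 part c.
  move=> i; apply/setP => j; rewrite inE /c; case: pickP => [i' | no].
    move=> /existsP[j' /andP[/eqP e jT]].
    have {e}-> : j = j' by apply/(@rank_ord_inj R n tl tr)/val_inj.
    apply/idP/eqP => [jTi | /val_inj<- //].
    congr nat_of_ord; apply/eqP/negPn/negP => /dT /disjointFr /(_ jT).
    by rewrite jTi.
  have -> : (m == i) = false by apply/negP => /eqP e; have := ltn_ord i; rewrite -e ltnn.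
  by apply/negP => jT; have /existsP[] := no i; exists j; rewrite eqxx.
exists c => //; apply: legalI => [r _|l r /andP[lr rn] cm clr|i im].
- exact: follows0.
- have [k ek] := rk_surj rn; have [j ej] := rk_surj (ltn_trans lr rn).
  move: lr cm clr; rewrite -ek -ej => lr cm clr; apply/(follows_rk lr).
  have [+ _] := hT (Ordinal cm); apply; rewrite ?hc ?inE //=; first exact/eqP.
  by apply/negP => /eqP e; rewrite e ltnn in lr.
- have [_] := hT (Ordinal im); rewrite feasibleE hc card_part.
  by [].
Qed.

Lemma greedy_optimal : optimal I (part (greedy m n (battery I) follows gain)).
Proof.
split=> [|T /admissible_legal[c hc Tc]]; first exact/legal_admissible/greedy_legal.
rewrite total_reward_part /total_reward.
under eq_bigr do rewrite Tc.
by rewrite -/(total_reward I (part c)) total_reward_part greedy_max.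
Qed.

End Instance.

(** * Table indices in positional notation *)

Fixpoint code (N : nat) (v : nat -> nat) (D : nat) : nat :=
  if D is D1.+1 then (code N v D1 * N + v D1)%N else 0.

Lemma eq_code N v w D :
  (forall d, (d < D)%N -> v d = w d) -> code N v D = code N w D.
Proof. by elim: D => //= D IH h; rewrite h // IH // => d hd; exact/h/ltnW. Qed.

(** Digits at most [n] are below the base, so division by [n.+1] strips the last one. *)
Lemma code_inj n v w D :
  (forall d, (d < D)%N -> (v d <= n)%N) -> (forall d, (d < D)%N -> (w d <= n)%N) ->
  code n.+1 v D = code n.+1 w D -> forall d, (d < D)%N -> v d = w d.
Proof.
elim: D => //= D IH hv hw e d.
have e1 : code n.+1 v D = code n.+1 w D.
  move: (congr1 (fun x => x %/ n.+1)%N e).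
  by rewrite !divnMDl // !divn_small ?addn0 ?ltnS ?hv ?hw.
rewrite ltnS leq_eqVlt => /orP[/eqP-> | hd]; first by move: e; rewrite e1 => /addnI.
by apply: IH => // k hk; [exact/hv/ltnW | exact/hw/ltnW].
Qed.

(** * The programs, the arrays they write and their well-formedness *)

Section Programs.
Variable m : nat.

(* Natural-number arrays 0, ..., m - 1 are the output.  Scalars live in cell 0
   of their own array; array dg d holds digit d of the current state and cr, the
   digit after the last one, the current position.  Cell 0 of array cord is the
   dummy job n, cell r + 1 the job at position r.  Number arrays: rtab is the
   table of the dynamic program, rnat the naturals embedded in R (to compare
   counts with the battery), rbest the running maximum. *)
Notation cn := (m + 0)%N.
Notation cN := (m + 1)%N.
Notation cidx := (m + 2)%N.
Notation ctmp := (m + 3)%N.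
Notation cy := (m + 4)%N.
Notation cx := (m + 5)%N.
Notation cchoice := (m + 6)%N.
Notation cord := (m + 7)%N.
Notation cj := (m + 8)%N.
Notation ck := (m + 9)%N.
Notation crank := (m + 10)%N.
Notation dg d := (m + 11 + d)%N.
Notation rtab := 5%N.
Notation rnat := 6%N.
Notation rbest := 7%N.
Notation NC := NConst.
Notation succ e := (NAdd e (NConst 1)).

Definition tor b1 b2 := TNot (TAnd (TNot b1) (TNot b2)).
Definition nlt e1 e2 := TNot (NLe e2 e1).
Definition rlt e1 e2 := TNot (RLe e2 e1).

(** In each Horner step [ctmp] collects [cN] copies of [cidx] in place of a product. Digits are
    given as expressions so that the index of a successor state is obtained without storing that
    state. *)
Fixpoint code_prog (e : nat -> nexp) (D : nat) : prog :=
  if D is D1.+1 then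
    PSeq (code_prog e D1)
   (PSeq (PNat ctmp (NC 0) (NC 0))
   (PSeq (PFor cy cN (PNat ctmp (NC 0) (NAdd (var ctmp) (var cidx))))
         (PNat cidx (NC 0) (NAdd (var ctmp) (e D1)))))
  else PNat cidx (NC 0) (NC 0).

Lemma nwrites_code e D a : nwrites (code_prog e D) a -> (m + 2 <= a <= m + 4)%N.
Proof.
elim: D => [|D IH] /=; first by lia.
by move=> /orP[/IH// | ]; lia.
Qed.

Lemma rwrites_code e D a : rwrites (code_prog e D) a = false.
Proof. by elim: D => //= D ->. Qed.

Notation bounds := [:: cn; cN].

Lemma wf_code e D : wf bounds (code_prog e D).
Proof. by elim: D => [|D IH] /=; rewrite ?IH !inE; lia. Qed.

(** A digit expression is evaluated after the scratch arrays have changed, hence the hypothesis on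
    every [M1] that agrees with [M] in cell 0 of the other arrays. *)
Lemma run_code (R : realFieldType) e D (M : memory R) v :
  (forall d (M1 : memory R), (d < D)%N ->
     (forall a, ~~ (m + 2 <= a <= m + 4)%N -> nats M1 a 0 = nats M a 0) ->
     neval M1 (e d) = v d) ->
  nats (run (code_prog e D) M) cidx 0 = code (nats M cN 0) v D.
Proof.
elim: D => [|D IH] he; first by rewrite /= /update !eqxx.
have {}IH : nats (run (code_prog e D) M) cidx 0 = code (nats M cN 0) v D.
  by apply: IH => d M1 hd; apply/he/ltnW.
rewrite [code_prog _ _]/=; set p := code_prog e D in IH *.
have fr a : ~~ (m + 2 <= a <= m + 4)%N -> nats (run p M) a 0 = nats M a 0.
  by move=> ha; apply: nats_run; apply: contra ha; exact: nwrites_code.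
set q := PFor _ _ _; rewrite -[run _ M]/(run (PNat cidx (NC 0) (NAdd (var ctmp) (e D)))
  (run q (setn (run p M) ctmp 0 0))).
set M1 := setn _ _ _ _; set c := code _ _ _ in IH *.
have M1E a : (a == ctmp) = false -> nats M1 a 0 = nats (run p M) a 0.
  by move=> ha; rewrite nats_setn ha.
have hN : nats M1 cN 0 = nats M cN 0 by rewrite M1E ?fr //; lia.
have hidx : nats M1 cidx 0 = c by rewrite M1E //; lia.
have hq : nats (run q M1) ctmp 0 = (nats M cN 0 * c)%N /\ nats (run q M1) cidx 0 = c.
  rewrite -hN; apply: (run_for (P := fun i M2 =>
    nats M2 ctmp 0 = (i * c)%N /\ nats M2 cidx 0 = c)).
  - by rewrite /= !eqn_add2l.
  - by rewrite !nats_setn !eqn_add2l.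
  - move=> i M2 _ _ [h1 h2].
    by rewrite /= /update !eqn_add2l /= h1 h2 mulSn addnC.
have [h1 _] := hq.
have fr2 a : ~~ (m + 2 <= a <= m + 4)%N -> nats (run q M1) a 0 = nats M a 0.
  move=> ha; rewrite nats_run; last by rewrite /q /=; lia.
  by rewrite M1E ?fr //; lia.
move: (run q M1) h1 fr2 => M2 h1 fr2.
by rewrite /= /update !eqxx /= h1 mulnC (he D M2).
Qed.

#[local] Opaque code_prog.

Notation width := (m + m).+1.
Notation cr := (dg (m + m)).

Definition self_code := code_prog (fun d => var (dg d)) width.

(** Successor states are looked up at the next position, whence the incremented [cr] as last
    digit. *)
Definition skip_code :=
  code_prog (fun d => if d == (m + m)%N then succ (var cr) else var (dg d)) width.

Definition place_code i :=
  code_prog (fun d => if d == (m + m)%N then succ (var cr)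
                      else if d == i then succ (var cr)
                      else if d == (m + i)%N then succ (var (dg d))
                      else var (dg d)) width.

Definition empty_test k := RLe (RGet 2 k) (RGet 1 k).

Definition apart_test k j := tor (empty_test k) (RLe (RGet 2 k) (RGet 1 j)).

Definition prec_test k j :=
  tor (TAnd (empty_test k) (tor (TNot (empty_test j)) (nlt k j)))
      (TAnd (TAnd (TNot (empty_test k)) (TNot (empty_test j)))
            (tor (rlt (RGet 1 k) (RGet 1 j))
                 (TAnd (RLe (RGet 1 k) (RGet 1 j)) (nlt k j)))).

Definition allowed_test i :=
  TAnd (RLe (RGet rnat (succ (var (dg (m + i))))) (RGet 0 (NC 0)))
       (apart_test (NGet cord (var (dg i))) (NGet cord (succ (var cr)))).

Definition candidate :=
  RAdd (RGet rtab (var cidx)) (RGet 4 (NGet cord (succ (var cr)))).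

Definition try_prog i :=
  PIf (allowed_test i)
    (PSeq (place_code i)
      (PIf (rlt (RGet rbest (NC 0)) candidate)
        (PSeq (PNum rbest (NC 0) candidate) (PNat cchoice (NC 0) (NC i)))
        PNop))
    PNop.

Definition best_prog :=
  PSeq skip_code
 (PSeq (PNum rbest (NC 0) (RGet rtab (var cidx)))
 (PSeq (PNat cchoice (NC 0) (NC m))
       (unroll try_prog m))).

(** The bound is [cN] because a digit takes the [n.+1] values from 0 to [n]. *)
Fixpoint nest (D : nat) (p : prog) : prog :=
  if D is D1.+1 then PFor (dg D1) cN (nest D1 p) else p.

Definition entry_prog :=
  PSeq best_prog (PSeq self_code (PNum rtab (var cidx) (RGet rbest (NC 0)))).

(** For-loops only count upwards, so the backward sweep derives its position [n - (cx + 1)] from the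
    counter. *)
Definition fill_prog :=
  PFor cx cn
    (PSeq (PNat cr (NC 0) (NSub (var cn) (succ (var cx))))
          (nest (m + m) entry_prog)).

(** Every drone tests whether it is the chosen one; the choice [m] passes none of these tests. *)
Definition place_prog i :=
  PIf (TAnd (NLe (var cchoice) (NC i)) (NLe (NC i) (var cchoice)))
    (PSeq (PNat i (NGet cord (succ (var cr))) (NC 1))
    (PSeq (PNat (dg i) (NC 0) (succ (var cr)))
          (PNat (dg (m + i)) (NC 0) (succ (var (dg (m + i)))))))
    PNop.

Definition walk_prog :=
  PSeq (unroll (fun d => PNat (dg d) (NC 0) (NC 0)) (m + m))
       (PFor cr cn (PSeq best_prog (unroll place_prog m))).

Definition nat_prog :=
  PFor cx cn (PNum rnat (succ (var cx)) (RAdd (RGet rnat (var cx)) ROne)).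

Definition rank_prog :=
  PSeq (PNat crank (NC 0) (NC 0))
       (PFor ck cn
          (PIf (prec_test (var ck) (var cj))
             (PNat crank (NC 0) (succ (var crank))) PNop)).

Definition ord_prog :=
  PSeq (PNat cord (NC 0) (var cn))
       (PFor cj cn (PSeq rank_prog (PNat cord (succ (var crank)) (var cj)))).

(** Array 0 carries the input [n] and later the output of drone 0, so [n] is saved and its cell
    cleared. *)
Definition init_prog :=
  PSeq (PNat cn (NC 0) (var 0))
 (PSeq (PNat cN (NC 0) (succ (var 0)))
       (PNat 0 (NC 0) (NC 0))).

Definition sort_prog := PSeq nat_prog ord_prog.

Definition main_prog := PSeq sort_prog (PSeq fill_prog walk_prog).

Lemma nwrites_try i a :
  nwrites (try_prog i) a -> (m + 2 <= a <= m + 4)%N || (a == cchoice).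
Proof.
rewrite /try_prog /= !orbF; case/orP => [/nwrites_code | ]; last by lia.
by move=> ->.
Qed.

Lemma rwrites_try i a : rwrites (try_prog i) a -> a = rbest.
Proof. by rewrite /try_prog /= rwrites_code /= !orbF => /eqP. Qed.

Lemma nwrites_best a :
  nwrites best_prog a -> (m + 2 <= a <= m + 4)%N || (a == cchoice).
Proof.
rewrite /best_prog /= => /orP[/nwrites_code-> // | /orP[->|]]; first by rewrite orbT.
by case/nwrites_unroll => i _ /nwrites_try.
Qed.

Lemma rwrites_best a : rwrites best_prog a -> a = rbest.
Proof.
rewrite /best_prog /= rwrites_code /= => /orP[/eqP // |].
by case/rwrites_unroll => i _ /rwrites_try.
Qed.

Lemma nwrites_entry a :
  nwrites entry_prog a -> (m + 2 <= a <= m + 4)%N || (a == cchoice).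
Proof.
by rewrite /entry_prog /= orbF => /orP[/nwrites_best | /nwrites_code->].
Qed.

Lemma rwrites_entry a : rwrites entry_prog a -> (a == rbest) || (a == rtab).
Proof.
rewrite -[rwrites _ _]/(rwrites best_prog a || (rwrites self_code a || (a == rtab))).
by rewrite [rwrites self_code a]rwrites_code => /orP[/rwrites_best-> | /eqP->].
Qed.

Lemma nwrites_nest D p a :
  nwrites (nest D p) a -> nwrites p a || (m + 11 <= a < m + 11 + D)%N.
Proof.
elim: D => [|D IH] /=; first by move=> ->.
by move=> /orP[/eqP-> | /IH/orP[-> // | h]]; apply/orP; right; lia.
Qed.

Lemma rwrites_nest D p a : rwrites (nest D p) a = rwrites p a.
Proof. by elim: D. Qed.

Lemma nwrites_place i a :
  nwrites (place_prog i) a -> [|| a == i, a == dg i | a == dg (m + i)].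
Proof. by rewrite /place_prog /= orbF. Qed.

Lemma wf_best : wf bounds best_prog.
Proof.
rewrite /best_prog /= wf_code wf_unroll ?andbT /= => [|i _]; first by rewrite !inE; lia.
by rewrite wf_code /= andbT !inE; lia.
Qed.

Lemma wf_nest D p : (forall d, (d < D)%N -> ~~ nwrites p (dg d)) ->
  wf bounds p -> wf bounds (nest D p).
Proof.
elim: D => //= D IH h w; rewrite IH //; last by move=> d hd; apply/h/ltnW.
rewrite !inE !andbT; apply/and3P; split; try by lia.
apply/negP => /nwrites_nest; rewrite (negPf (h _ _)) //; lia.
Qed.

Lemma wf_fill : wf bounds fill_prog.
Proof.
rewrite -[wf _ _]/[&& cx \notin bounds, cn \in bounds,
  ~~ ((cx == cr) || nwrites (nest (m + m) entry_prog) cx), cr \notin bounds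
  & wf bounds (nest (m + m) entry_prog)].
rewrite wf_nest; first last.
- rewrite -[wf _ _]/(wf bounds best_prog && (wf bounds self_code && true)).
  by rewrite wf_best [wf _ _]wf_code.
- by move=> d hd; apply/negP => /nwrites_entry; lia.
rewrite !inE andbT; apply/and4P; split; try by lia.
by apply/negP => /orP[|/nwrites_nest /orP[/nwrites_entry|]]; lia.
Qed.

Lemma wf_walk : wf bounds walk_prog.
Proof.
rewrite -[wf _ _]/(wf bounds (unroll (fun d => PNat (dg d) (NC 0) (NC 0)) (m + m)) &&
  [&& cr \notin bounds, cn \in bounds,
      ~~ (nwrites best_prog cr || nwrites (unroll place_prog m) cr),
      wf bounds best_prog & wf bounds (unroll place_prog m)]).
rewrite wf_best !wf_unroll; first last.
- by move=> i _; rewrite /= !inE; lia.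
- by move=> i im; rewrite /= !inE; lia.
rewrite !inE !andbT eqxx /=; apply/andP; split; first by lia.
apply/negP => /orP[/nwrites_best | /nwrites_unroll[i im /nwrites_place]]; lia.
Qed.

Lemma wf_main : wf bounds main_prog.
Proof.
apply/and3P; split; [by rewrite /= !inE; lia | exact: wf_fill | exact: wf_walk].
Qed.

(** * The programs compute the dynamic program *)

Section Correctness.
Variables (R : realFieldType) (n : nat) (I : mdsp R n).
Variable ord : nat -> nat.
Implicit Type M : memory R.
Notation tl := (load (tL I)).
Notation tr := (load (tR I)).

Lemma teval_tor M b1 b2 : teval M (tor b1 b2) = teval M b1 || teval M b2.
Proof. by rewrite /= negb_and !negbK. Qed.

(** What sorting leaves in memory and the later programs only read. *)
Record env M : Prop := Env {
  env_n : nats M cn 0 = n;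
  env_N : nats M cN 0 = n.+1;
  env_ord : forall k, nats M cord k = ord k;
  env_bat : nums M 0 0 = battery I;
  env_tl : forall k, nums M 1 k = tl k;
  env_tr : forall k, nums M 2 k = tr k;
  env_rew : forall k, nums M 4 k = load (reward I) k;
  env_nat : forall k, (k <= n)%N -> nums M rnat k = k%:R }.

Lemma env_eq M M1 :
  (forall a k, a \in [:: cn; cN; cord] -> nats M1 a k = nats M a k) ->
  (forall a k, a \in [:: 0%N; 1; 2; 4; rnat]%N -> nums M1 a k = nums M a k) ->
  env M -> env M1.
Proof.
move=> hn hr [e1 e2 e3 e4 e5 e6 e7 e8].
by split=> *; rewrite ?hn ?hr ?inE ?eqxx ?orbT //; auto.
Qed.

Lemma env_run p M :
  (forall a, nwrites p a -> a \notin [:: cn; cN; cord]) ->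
  (forall a, rwrites p a -> a \notin [:: 0%N; 1; 2; 4; rnat]%N) ->
  env M -> env (run p M).
Proof.
move=> hn hr; apply: env_eq => a k ha.
  by rewrite nats_run //; apply: contraL ha => /hn.
by rewrite nums_run //; apply: contraL ha => /hr.
Qed.

Lemma env_setn M a k v : a \notin [:: cn; cN; cord] -> env M -> env (setn M a k v).
Proof.
move=> ha; apply: env_eq => // a' k' ha'; rewrite nats_setn.
by case: eqP => //= e; rewrite e (negPf ha) in ha'.
Qed.

Definition slot r (v : nat -> nat) :=
  code n.+1 (fun d => if d == (m + m)%N then r else v d) width.

Lemma slot_inj r s v w : (r <= n)%N -> (s <= n)%N ->
  (forall d, (d < m + m)%N -> (v d <= n)%N) ->
  (forall d, (d < m + m)%N -> (w d <= n)%N) ->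
  slot r v = slot s w -> r = s /\ same m v w.
Proof.
move=> hr hs hv hw /code_inj h.
have {}h d : (d < width)%N -> (if d == (m + m)%N then r else v d) =
                             (if d == (m + m)%N then s else w d).
  apply: h => {}d hd; case: eqP => // ne; [apply: hv | apply: hw]; lia.
split; first by have := h _ (ltnSn (m + m)); rewrite eqxx.
move=> d hd; have := h d (leqW hd).
by rewrite (_ : (d == (m + m)%N) = false) //; lia.
Qed.

Definition digits M r v :=
  nats M cr 0 = r /\ forall d, (d < m + m)%N -> nats M (dg d) 0 = v d.

(** Before position [r] all digits of a state are at most [r]. The loops also fill entries for
    larger digits, about which nothing is claimed; no entry covered here is computed from them. *)
Definition table M r F :=
  forall w, (forall d, (d < m + m)%N -> (w d <= r)%N) -> nums M rtab (slot r w) = F w.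

Notation allowed := (allowed m (battery I) (follows I ord)).
Notation best := (best m (battery I) (follows I ord) (gain I ord)).
Notation value := (value m n (battery I) (follows I ord) (gain I ord)).

Lemma teval_prec M k j :
  (forall i, nums M 1 i = tl i) -> (forall i, nums M 2 i = tr i) ->
  teval M (prec_test k j) = prec tl tr (neval M k) (neval M j).
Proof.
move=> h1 h2; rewrite /= !h1 !h2 /prec /empty ltnNge ltNge.
by do 4 case: (_ <= _); case: (_ <= _)%N.
Qed.

(** The bound on the count keeps its successor within the filled part of [rnat]. *)
Lemma teval_allowed M r v i : env M -> digits M r v -> (i < m)%N ->
  (v (m + i) < n)%N -> teval M (allowed_test i) = allowed r v i.
Proof.
move=> eM [hr hv] im hi; rewrite /allowed_test -[LHS]/(_ && teval M (apart_test _ _)).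
rewrite teval_tor /= hr !hv; try by lia.
rewrite !(env_ord eM) !(env_tl eM) !(env_tr eM) (env_bat eM).
by rewrite (env_nat eM) !addn1.
Qed.

Lemma run_best M r v F :
  env M -> digits M r v -> (r < n)%N ->
  (forall d, (d < m + m)%N -> (v d <= r)%N) -> table M r.+1 F ->
  nums (run best_prog M) rbest 0 = (best F r v m).1 /\
  nats (run best_prog M) cchoice 0 = (best F r v m).2.
Proof.
move=> eM dM rn vr tM; rewrite /best_prog.
rewrite -[run _ M]/(run (unroll try_prog m) (setn (setr (run skip_code M) rbest 0
   (nums (run skip_code M) rtab (nats (run skip_code M) cidx 0))) cchoice 0 m)).
set M1 := run skip_code M.
set M2 := setn _ _ _ _.
have fr1 a k : ~~ (m + 2 <= a <= m + 4)%N -> nats M1 a k = nats M a k.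
  by move=> ha; apply: nats_run; apply: contra ha; exact: nwrites_code.
have frr1 a k : nums M1 a k = nums M a k by rewrite nums_run // [rwrites _ _]rwrites_code.
have idx1 : nats M1 cidx 0 = slot r.+1 v.
  rewrite /slot -(env_N eM); apply: run_code => d M3 hd h.
  have [hr hv] := dM.
  case: ifP => [_|/eqP ne] /=; first by rewrite h ?hr ?addn1 //; lia.
  by rewrite h ?hv //; lia.
have vr1 d : (d < m + m)%N -> (v d <= r.+1)%N by move=> hd; apply/leqW/vr.
(* The attempts are unrolled in the order in which [best] recurses over the drones, so the
   accumulators hold [best] for the first [k] drones. *)
suff: forall k, (k <= m)%N -> let M3 := run (unroll try_prog k) M2 in
    nums M3 rbest 0 = (best F r v k).1 /\ nats M3 cchoice 0 = (best F r v k).2.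
  by apply.
elim=> [_|k IH km].
  rewrite /= /update !eqxx; split=> //.
  by rewrite -/M1 idx1 frr1 (tM _ vr1).
have {IH} := IH (ltnW km).
rewrite -[run (unroll _ k.+1) M2]/(run (try_prog k) (run (unroll try_prog k) M2)).
set p := unroll try_prog k; cbv zeta => -[hb hc].
have fr a j : ~~ (m + 2 <= a <= m + 4)%N -> (a == cchoice) = false ->
    nats (run p M2) a j = nats M a j.
  move=> ha hac; rewrite nats_run; last first.
    by apply/negP => /nwrites_unroll[i _ /nwrites_try]; rewrite hac orbF (negPf ha).
  by rewrite nats_setn hac /= fr1.
have frr a j : a != rbest -> nums (run p M2) a j = nums M a j.
  move=> ha; rewrite nums_run; last first.
    by apply/negP => /rwrites_unroll[i _ /rwrites_try /eqP]; rewrite (negPf ha).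
  by rewrite /M2 /= /update (negPf ha) /= -/M1 frr1.
set M3 := run p M2 in hb hc fr frr *.
have eM3 : env M3.
  apply: env_eq eM => a j; rewrite !inE => ha; first by rewrite fr //; lia.
  by rewrite frr //; lia.
have dM3 : digits M3 r v.
  by have [hr hv] := dM; split=> [|d hd]; rewrite fr ?hr ?hv //; lia.
have vk : (v (m + k) < n)%N by apply: leq_ltn_trans rn; apply: vr; lia.
set M4 := run (place_code k) M3.
pose upd := PIf (rlt (RGet rbest (NC 0)) candidate)
  (PSeq (PNum rbest (NC 0) candidate) (PNat cchoice (NC 0) (NC k))) PNop.
rewrite -[run _ M3]/(if teval M3 (allowed_test k) then run upd M4 else M3).
rewrite (teval_allowed eM3 dM3 km vk) /=.
case al: (allowed r v k) => //=.
have idx4 : nats M4 cidx 0 = slot r.+1 (place m v k r).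
  rewrite /slot -(env_N eM3); apply: run_code => d M5 hd h.
  have [hr hv] := dM3.
  case: ifP => [_|/eqP ne] /=; first by rewrite h ?hr ?addn1 //; lia.
  rewrite /place; case: ifP => [_|_] /=; first by rewrite h ?hr ?addn1 //; lia.
  by case: ifP => _ /=; rewrite h ?hv ?addn1 //; lia.
have pr d : (d < m + m)%N -> (place m v k r d <= r.+1)%N.
  by move=> hd; rewrite /place; do 2 case: ifP => // _; rewrite ?ltnS ?vr ?vr1.
have fr4 a : ~~ (m + 2 <= a <= m + 4)%N -> forall j, nats M4 a j = nats M3 a j.
  by move=> ha j; apply: nats_run; apply: contra ha; exact: nwrites_code.
have frr4 a j : nums M4 a j = nums M3 a j by rewrite nums_run // [rwrites _ _]rwrites_code.
have cE : nums M4 rtab (nats M4 cidx 0) +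
    nums M4 4 (nats M4 cord (nats M4 cr 0 + 1)) = F (place m v k r) + gain I ord r.
  have [hr _] := dM3.
  rewrite idx4 !frr4 !fr4 ?hr; try by lia.
  by rewrite (env_ord eM3) (env_rew eM3) frr // tM // addn1.
rewrite cE !frr4 hb -ltNge.
case: ifP => _ /=; rewrite /update /= ?eqxx /= ?cE //.
by rewrite frr4 fr4 //; lia.
Qed.

(** [Done w] records that the body has treated the digit vector [w], and it must survive all later
    rounds. The [D] inner loops treat every completion of the outer digits in memory, so a vector is
    either treated already or agrees with memory on those digits. *)
Lemma run_nest (Inv : memory R -> Prop) (Done : (nat -> nat) -> memory R -> Prop) p :
  (forall d, (d < m + m)%N -> ~~ nwrites p (dg d)) ->
  (forall M, Inv M -> nats M cN 0 = n.+1) ->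
  (forall M d k, (d < m + m)%N -> Inv M -> Inv (setn M (dg d) 0 k)) ->
  (forall M w d k, (d < m + m)%N -> Done w M -> Done w (setn M (dg d) 0 k)) ->
  (forall M, Inv M -> (forall d, (d < m + m)%N -> (nats M (dg d) 0 <= n)%N) ->
     Inv (run p M) /\
     forall w, Done w M \/ (forall d, (d < m + m)%N -> nats M (dg d) 0 = w d) ->
       Done w (run p M)) ->
  forall D M, (D <= m + m)%N -> Inv M ->
  (forall d, (D <= d < m + m)%N -> (nats M (dg d) 0 <= n)%N) ->
  Inv (run (nest D p) M) /\
  forall w, Done w M \/ (forall d, (d < D)%N -> (w d <= n)%N) /\
              (forall d, (D <= d < m + m)%N -> nats M (dg d) 0 = w d) ->
    Done w (run (nest D p) M).
Proof.
move=> hp hN hI hD hB; elim=> [|D IH] M hDm iM dM.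
  have [h1 h2] := hB M iM dM; split=> // w [h|[_ h]]; apply: h2; first by left.
  by right.
have frD d : (D < d < m + m)%N -> ~~ nwrites (nest D p) (dg d).
  by move=> hd; apply/negP => /nwrites_nest; rewrite (negPf (hp _ _)) /=; lia.
rewrite -[nest D.+1 p]/(PFor (dg D) cN (nest D p)).
have := @run_for R (fun i M1 => [/\ Inv M1,
    forall d, (D < d < m + m)%N -> nats M1 (dg d) 0 = nats M (dg d) 0
  & forall w, Done w M \/ [/\ forall d, (d < D.+1)%N -> (w d <= n)%N, (w D < i)%N
        & forall d, (D < d < m + m)%N -> nats M (dg d) 0 = w d] -> Done w M1])
  (dg D) cN (nest D p) M.
rewrite (hN M iM) => /(_ _ _ _) [].
- by apply/negP => /nwrites_nest; rewrite (negPf (hp _ _)) /=; lia.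
- split=> [|d hd|w [h|[]//]]; [exact: hI | | exact: hD].
  by rewrite nats_setn eqn_add2l (_ : (d == D) = false) //; lia.
- move=> i M1 hi ei [iM1 d1 w1].
  have [|//|d hd|h1 h2] := IH M1; first exact: ltnW.
    by have [e|ne] := eqVneq d D; [rewrite e ei; lia | rewrite d1 ?dM //; lia].
  split=> [|d hd|w hw]; first exact: hI.
    by rewrite nats_setn eqn_add2l (_ : (d == D) = false) /= ?nats_run ?frD ?d1 //; lia.
  apply: hD => //; apply: h2.
  case: hw => [h|[hw1 hw2 hw3]]; first by left; apply: w1; left.
  move: hw2; rewrite ltnS leq_eqVlt => /orP[/eqP e | hw2]; last first.
    by left; apply: w1; right.
  right; split=> [d hd|d hd]; first exact/hw1/ltnW.
  have [->|ne] := eqVneq d D; first by rewrite ei e.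
  by rewrite d1 ?hw3 //; lia.
move=> h1 _ h2; split=> // w hw; apply: h2.
case: hw => [h|[h3 h4]]; [by left | right; split=> //; exact: h3].
Qed.

Definition tables M r0 :=
  forall r, (r0 <= r <= n)%N -> table M r (value (n - r)).

Definition entry M r w :=
  (forall d, (d < m + m)%N -> (w d <= r)%N) -> nums M rtab (slot r w) = value (n - r) w.

(** Only one slot is written, and [slot_inj] separates it from the rows after [r] and from the other
    states of row [r]. *)
Lemma run_entry M r : env M -> nats M cr 0 = r -> (r < n)%N -> tables M r.+1 ->
  (forall d, (d < m + m)%N -> (nats M (dg d) 0 <= n)%N) ->
  tables (run entry_prog M) r.+1 /\
  forall w, entry M r w \/ (forall d, (d < m + m)%N -> nats M (dg d) 0 = w d) ->
    entry (run entry_prog M) r w.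
Proof.
move=> eM hr rn tM; set v := fun d => nats M (dg d) 0 => dM.
pose M1 := run best_prog M; pose M2 := run self_code M1.
have fr1 a k : ~~ (m + 2 <= a <= m + 4)%N -> a != cchoice -> nats M1 a k = nats M a k.
  by move=> h1 h2; apply: nats_run; apply/negP => /nwrites_best; rewrite (negPf h1) (negPf h2).
have frr1 a k : a != rbest -> nums M1 a k = nums M a k.
  by move=> h; apply: nums_run; apply: contra h => /rwrites_best->.
have frr2 a k : nums M2 a k = nums M1 a k by rewrite nums_run // [rwrites _ _]rwrites_code.
have idx2 : nats M2 cidx 0 = slot r v.
  rewrite /slot -(env_N eM) -[nats M cN 0]fr1; try by lia.
  apply: run_code => d M3 hd h /=; rewrite h; last by lia.
  by case: eqP => [->|_]; rewrite fr1 //; lia.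
have tabE k : nums (run entry_prog M) rtab k =
    if k == slot r v then nums M1 rbest 0 else nums M rtab k.
  rewrite -[run entry_prog M]/(setr M2 rtab (nats M2 cidx 0) (nums M2 rbest 0)).
  by rewrite nums_setr idx2 !frr2 eqxx /=; case: ifP => // _; rewrite frr1.
split=> [s hs w hw|w hw wr]; rewrite tabE.
  case: eqP => [E|_]; last exact: tM.
  have [||d hd|d hd|e _] := slot_inj _ _ _ _ E; try by lia.
    by have := hw d hd; lia.
  exact: dM.
have wn d : (d < m + m)%N -> (w d <= n)%N by move=> hd; have := wr d hd; lia.
case: eqP => [/(slot_inj (ltnW rn) (ltnW rn) wn dM)[_ wv] | ne]; last first.
  case: hw => [|h]; first exact.
  (* Here the digits in memory are those of [w], so the two slots would coincide. *)
  case: ne; apply: eq_code => d; case: eqP => // ne hd; rewrite -h //; lia.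
have [|d hd||-> _] := @run_best M r v (value (n - r.+1)) eM _ rn.
- by split.
- by have := wr d hd; rewrite (wv d hd).
- by apply: tM; lia.
have -> : (n - r)%N = (n - r.+1).+1 by lia.
rewrite [RHS](value_same n (battery I) (follows I ord) (gain I ord) _ wv) /=.
by have -> : (n - (n - r.+1).+1)%N = r by lia.
Qed.

Lemma run_fill M : env M -> (forall k, nums M rtab k = 0) ->
  env (run fill_prog M) /\ tables (run fill_prog M) 0.
Proof.
move=> eM t0.
pose body := PSeq (PNat cr (NC 0) (NSub (var cn) (succ (var cx)))) (nest (m + m) entry_prog).
have ebody M1 : env M1 -> env (run body M1).
  apply: env_run => a.
    rewrite -[nwrites _ _]/((a == cr) || nwrites (nest (m + m) entry_prog) a) !inE.
    by case/orP => [|/nwrites_nest/orP[/nwrites_entry|]]; lia.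
  rewrite -[rwrites _ _]/(rwrites (nest (m + m) entry_prog) a) rwrites_nest !inE.
  by move/rwrites_entry; lia.
have := @run_for R (fun i M1 => env M1 /\ tables M1 (n - i)) cx cn body M.
rewrite (env_n eM) subnn; apply.
- rewrite -[nwrites _ _]/((cx == cr) || nwrites (nest (m + m) entry_prog) cx).
  by apply/negP; case/orP => [|/nwrites_nest/orP[/nwrites_entry|]]; lia.
- split; first by apply: env_setn => //; rewrite !inE; lia.
  (* Row [n] requires no computation: [value 0] is 0, and so is every cell of the fresh table. *)
  move=> r hr w _; rewrite subn0 in hr; have -> : r = n by lia.
  by rewrite subnn /= t0.
move=> i M1 hi ei [eM1 tM1]; split.
  by apply: env_setn; [rewrite !inE; lia | exact: ebody].
set r := (n - i.+1)%N; have rn : (r < n)%N by rewrite /r; lia.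
have {}tM1 : tables M1 r.+1 by rewrite (_ : r.+1 = (n - i)%N) // /r; lia.
pose M2 := setn M1 cr 0 r.
have -> : run body M1 = run (nest (m + m) entry_prog) M2.
  by rewrite /body /= ei (env_n eM1) addn1.
have [|||||||[_ _ t1] t2] := @run_nest
  (fun M3 => [/\ env M3, nats M3 cr 0 = r & tables M3 r.+1])
  (fun w M3 => entry M3 r w) entry_prog _ _ _ _ _ (m + m) M2 (leqnn _).
- by move=> d hd; apply/negP => /nwrites_entry; lia.
- by move=> M3 [/env_N].
- move=> M3 d k hd [e3 c3 t3]; split=> //.
    by apply: env_setn => //; rewrite !inE; lia.
  by rewrite nats_setn eqn_add2l (_ : (m + m == d)%N = false) //; lia.
- by [].
- move=> M3 [e3 c3 t3] d3; have [h1 h2] := run_entry e3 c3 rn t3 d3.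
  split=> //; split=> //.
    by apply: env_run e3 => a; [move/nwrites_entry | move/rwrites_entry]; rewrite !inE; lia.
  by rewrite nats_run //; apply/negP => /nwrites_entry; lia.
- split=> //; first by apply: env_setn => //; rewrite !inE; lia.
  by rewrite nats_setn !eqxx.
- by move=> d hd; lia.
move=> s hs w ws; have [e|ne] := eqVneq s r; last by apply: t1 => //; lia.
subst s; apply: t2 => //; right; split=> [d hd|d hd]; last by lia.
by have := ws d hd; lia.
Qed.

Lemma run_place M r v k (c := nats M cchoice 0) :
  (k <= m)%N -> env M -> digits M r v ->
  let M1 := run (unroll place_prog k) M in
  digits M1 r (if (c < k)%N then place m v c r else v) /\
  forall i j, (i < m)%N -> nats M1 i j =
    if [&& (c < k)%N, i == c & j == ord r.+1] then 1%N else nats M i j.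
Proof.
move=> + eM dM; elim: k => [|k IH] km //=.
have [dM1 oM1] := IH (ltnW km).
have {IH} fr a j : (m <= a < m + 11)%N ->
    nats (run (unroll place_prog k) M) a j = nats M a j.
  move=> ha; apply: nats_run.
  by apply/negP => /nwrites_unroll[i ik /nwrites_place]; lia.
move: (run _ M) dM1 oM1 fr => M1 dM1 oM1 fr.
rewrite !(fr cchoice) -/c; try by lia.
case: ifP => h; last first.
  have -> : (c < k.+1)%N = (c < k)%N by lia.
  by [].
have ck : c = k by lia.
rewrite ck ltnn ltnSn /= in dM1 oM1 *; have [hr hv] := dM1.
have nn d : ((m + 11 + d)%N == k) = false by lia.
split.
  split=> [|d hd].
    rewrite !nats_setn !eqn_add2l nn (_ : (m == k) = false); last by lia.
    by rewrite (_ : (m + m == k)%N = false) //=; lia.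
  rewrite !nats_setn /= /update !nn !eqn_add2l eqxx !andbT /= /place.
  rewrite (_ : (m + k == k)%N = false) /=; last by lia.
  have [->|dk] := eqVneq d (m + k)%N.
    rewrite (_ : (m + k == k)%N = false) /=; last by lia.
    by rewrite hv ?addn1 //; lia.
  by case: eqP => [_|_]; rewrite ?hr ?addn1 ?hv.
move=> i j im; rewrite /= /update.
have -> : (i == dg (m + k)) = false by lia.
have -> : (i == dg k) = false by lia.
rewrite /= hr addn1 fr ?(env_ord eM); last by lia.
by rewrite oM1.
Qed.

Hypothesis ord_rank : forall j, (j < n)%N -> ord (rank n tl tr j).+1 = j.
Notation greedy := (greedy m n (battery I) (follows I ord) (gain I ord)).
Notation greedy_state := (greedy_state m n (battery I) (follows I ord) (gain I ord)).

(** Each round recomputes [best] at the state [greedy_state r]; by [trace_le] its digits are at most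
    [r], so the entries consulted are among those guaranteed by [tables]. *)
Lemma run_walk M : env M -> tables M 0 ->
  (forall i j, (i < m)%N -> nats M i j = 0%N) ->
  outputs (m := m) (run walk_prog M) (part I greedy).
Proof.
move=> eM tM oM.
pose M0 := run (unroll (fun d => PNat (dg d) (NC 0) (NC 0)) (m + m)) M.
have eM0 : env M0.
  apply: env_run eM => a; first by case/nwrites_unroll => d _ /=; rewrite !inE; lia.
  by case/rwrites_unroll.
have tM0 : tables M0 0.
  by move=> r hr w hw; rewrite nums_run ?tM //; apply/negP => /rwrites_unroll[].
have oM0 i j : (i < m)%N -> nats M0 i j = 0%N.
  move=> im; rewrite nats_run ?oM //.
  by apply/negP => /nwrites_unroll[d _] /=; lia.
have dM0 d : (d < m + m)%N -> nats M0 (dg d) 0 = 0%N.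
  rewrite /M0; elim: (m + m)%N => //= D IH hd.
  by rewrite /update eqn_add2l andbT; case: eqP => // ne; apply: IH; lia.
pose body := PSeq best_prog (unroll place_prog m).
have := @run_for R (fun r M1 => [/\ env M1, tables M1 0,
    forall d, (d < m + m)%N -> nats M1 (dg d) 0 = greedy_state r d
  & forall (i : 'I_m) (j : 'I_n), nats M1 i j =
      (rank n tl tr j < r)%N && (greedy (rank n tl tr j) == i) :> nat])
  cr cn body M0.
rewrite (env_n eM0) -[run _ M0]/(run walk_prog M) => /(_ _ _ _) [].
- rewrite -[nwrites _ _]/(nwrites best_prog cr || nwrites (unroll place_prog m) cr).
  apply/negP => /orP[/nwrites_best | /nwrites_unroll[i im /nwrites_place]]; lia.
- split=> [|//|d hd|i j]; first by apply: env_setn => //; rewrite !inE; lia.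
    by rewrite nats_setn eqn_add2l (_ : (d == m + m)%N = false) ?dM0 //; lia.
  rewrite nats_setn (_ : (val i == cr) = false) ?oM0 //.
  by have := ltn_ord i; rewrite /=; lia.
- move=> r M1 rn er [eM1 tM1 dM1 oM1].
  have [|d hd||_ hc] := @run_best M1 r (greedy_state r) (value (n - r.+1)) eM1 _ rn.
  + by split.
  + by rewrite -trace_greedy; apply: trace_le.
  + by apply: tM1.
  rewrite -/(greedy r) in hc.
  rewrite -[run body M1]/(run (unroll place_prog m) (run best_prog M1)).
  set M2 := run best_prog M1 in hc *.
  have fr a k : ~~ (m + 2 <= a <= m + 4)%N -> a != cchoice -> nats M2 a k = nats M1 a k.
    by move=> h1 h2; apply: nats_run; apply/negP => /nwrites_best; rewrite (negPf h1) (negPf h2).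
  have eM2 : env M2.
    by apply: env_run eM1 => a; [move/nwrites_best | move/rwrites_best]; rewrite !inE; lia.
  have dM2 : digits M2 r (greedy_state r).
    by split=> [|d hd]; [rewrite fr ?er | rewrite fr ?dM1]; rewrite //; lia.
  have [] := run_place (leqnn m) eM2 dM2; rewrite hc => -[_ hd] ho.
  split=> [|s hs w hw|d hdm|i j].
  + apply: env_setn; first by rewrite !inE; lia.
    apply: env_run eM2 => a; last by case/rwrites_unroll.
    by case/nwrites_unroll => i im /nwrites_place; rewrite !inE; lia.
  + rewrite [LHS]nums_run; last by apply/negP => /rwrites_unroll[].
    by rewrite nums_run ?tM1 //; apply/negP => /rwrites_best.
  + by rewrite nats_setn eqn_add2l (_ : (d == m + m)%N = false) ?hd //; lia.
  rewrite nats_setn (_ : (val i == cr) = false) /=; last first.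
    by have := ltn_ord i; rewrite /=; lia.
  rewrite ho // fr; try by have := ltn_ord i; rewrite /=; lia.
  rewrite oM1; set s := rank _ _ _ _.
  have -> : (val j == ord r.+1) = (s == r).
    have [j' ej] := rk_surj I rn; rewrite -ej (ord_rank (ltn_ord j')).
    by apply/eqP/eqP => [h | /rank_inj]; [rewrite /s h | apply].
  rewrite ltnS [(s <= r)%N]leq_eqVlt; have [->|ne] := eqVneq s r.
    have [e|ne] := eqVneq (val i) (greedy r).
      by rewrite -e ltn_ord ?eqxx /= ?eqxx.
    by rewrite !andbF.
  by rewrite !andbF.
by move=> _ _ _ ho i j; rewrite ho inE rank_ltn.
Qed.

End Correctness.

(** * Initialisation, sorting and assembly *)

Section Sorting.
Variables (R : realFieldType) (n : nat) (I : mdsp R n).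
Implicit Type M : memory R.
Notation tl := (load (tL I)).
Notation tr := (load (tR I)).

Lemma run_rank M j :
  nats M cn 0 = n -> nats M cj 0 = j ->
  (forall i, nums M 1 i = tl i) -> (forall i, nums M 2 i = tr i) ->
  nats (run rank_prog M) crank 0 = rank n tl tr j.
Proof.
move=> hn hj h1 h2.
pose body := PIf (prec_test (var ck) (var cj))
                 (PNat crank (NC 0) (succ (var crank))) PNop.
pose M0 := setn M crank 0 0.
rewrite -[run _ M]/(run (PFor ck cn body) M0).
have := @run_for R (fun i M1 => [/\ nats M1 cj 0 = j,
    forall i, nums M1 1 i = tl i, forall i, nums M1 2 i = tr i
  & nats M1 crank 0 = (\sum_(0 <= k < i) prec tl tr k j)%N]) ck cn body M0.
have -> : nats M0 cn 0 = n by rewrite nats_setn eqn_add2l.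
case=> //; first by rewrite /= orbF eqn_add2l.
  by split=> //; rewrite !nats_setn !eqn_add2l //= big_geq.
move=> i M1 hi ei [ej e1 e2 er].
rewrite -[run body M1]/(if teval M1 (prec_test (var ck) (var cj)) then _ else _).
rewrite (@teval_prec R n I M1 _ _ e1 e2) /= ei ej; split.
- by case: ifP => _; rewrite /= /update !eqn_add2l /=.
- by move=> k; rewrite -e1; case: ifP.
- by move=> k; rewrite -e2; case: ifP.
- rewrite big_nat_recr //= -er.
  by case: ifP => _; rewrite /= /update !eqn_add2l /= ?addn1 ?addn0.
Qed.

(** Ranks are distinct, so no round overwrites an earlier entry, and the shift by one protects the
    dummy job in cell 0. *)
Lemma run_ord M :
  nats M cn 0 = n ->
  (forall i, nums M 1 i = tl i) -> (forall i, nums M 2 i = tr i) ->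
  nats (run ord_prog M) cord 0 = n /\
  forall j, (j < n)%N -> nats (run ord_prog M) cord (rank n tl tr j).+1 = j.
Proof.
move=> hn h1 h2.
pose body := PSeq rank_prog (PNat cord (succ (var crank)) (var cj)).
pose M0 := setn M cord 0 n.
have -> : run ord_prog M = run (PFor cj cn body) M0 by rewrite /M0 -hn.
have := @run_for R (fun i M1 => [/\ nats M1 cn 0 = n,
    forall i, nums M1 1 i = tl i, forall i, nums M1 2 i = tr i,
    nats M1 cord 0 = n
  & forall j, (j < i)%N -> nats M1 cord (rank n tl tr j).+1 = j]) cj cn body M0.
have e0 : nats M0 cn 0 = n by rewrite nats_setn eqn_add2l.
rewrite e0; case=> //.
- by rewrite /= !eqn_add2l.
- by split=> //; rewrite !nats_setn !eqn_add2l.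
- move=> i M1 hi ei [en e1 e2 e3 e4].
  have fr a k : a != crank -> a != ck -> nats (run rank_prog M1) a k = nats M1 a k.
    by move=> ha hb; apply: nats_run; rewrite /= (negPf ha) (negPf hb) orbF.
  have frr a k : nums (run rank_prog M1) a k = nums M1 a k by apply: nums_run.
  rewrite -[run body M1]/(setn (run rank_prog M1) cord
    (nats (run rank_prog M1) crank 0 + 1) (nats (run rank_prog M1) cj 0)).
  rewrite (run_rank en ei e1 e2) fr ?eqn_add2l // ei addn1.
  split=> [|k|k||j].
  + by rewrite !nats_setn !eqn_add2l /= fr ?eqn_add2l.
  + by rewrite -[LHS]/(nums (run rank_prog M1) 1 k) frr.
  + by rewrite -[LHS]/(nums (run rank_prog M1) 2 k) frr.
  + by rewrite !nats_setn !eqn_add2l /= fr ?eqn_add2l.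
  rewrite ltnS leq_eqVlt => /orP[/eqP-> | ji]; first by rewrite !nats_setn !eqn_add2l !eqxx.
  rewrite !nats_setn !eqn_add2l eqSS /=.
  case: eqP => [[/(rank_inj (ltn_trans ji hi) hi) e] | _]; first by lia.
  by rewrite fr ?eqn_add2l ?e4.
Qed.

Lemma run_nat M : nats M cn 0 = n -> (forall k, nums M rnat k = 0) ->
  forall k, (k <= n)%N -> nums (run nat_prog M) rnat k = k%:R.
Proof.
move=> hn h0.
have := @run_for R (fun i M1 => forall k, (k <= i)%N -> nums M1 rnat k = k%:R)
  cx cn (PNum rnat (succ (var cx)) (RAdd (RGet rnat (var cx)) ROne)) M.
rewrite hn; apply=> // [k|i M1 hi ei h k]; first by rewrite leqn0 => /eqP->; exact: h0.
rewrite leq_eqVlt => /orP[/eqP-> | ki]; rewrite /= /update /= ei addn1.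
  by rewrite eqxx h // mulrS addrC.
by rewrite (_ : (k == i.+1) = false) ?h //; lia.
Qed.

Definition start := run init_prog (input I).

(** With [m] positive, the array holding the copy of [n] differs from array 0, whose first cell is
    cleared afterwards. *)
Lemma start_bounds (hm : (0 < m)%N) :
  nats start cn 0 = n /\ nats start cN 0 = n.+1.
Proof.
have h0 : (m + 0 == 0)%N = false by lia.
have h1 : (m + 1 == 0)%N = false by lia.
by rewrite /= /update /= !eqn_add2l h0 h1 /= eq_sym h0 /= addn1.
Qed.

Lemma env_sort (hm : (0 < m)%N) :
  env I (nats (run sort_prog start) cord) (run sort_prog start).
Proof.
have [s0 s1] := start_bounds hm.
have frr a k : a != rnat -> nums (run sort_prog start) a k = nums start a k.
  by move=> ha; apply: nums_run; rewrite /= orbF.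
split=> //; try by move=> k; rewrite frr.
- by rewrite nats_run ?s0 //= !eqn_add2l.
- by rewrite nats_run ?s1 //= !eqn_add2l.
- by rewrite frr.
- move=> k kn; rewrite -[run sort_prog _]/(run ord_prog (run nat_prog start)).
  by rewrite nums_run // run_nat.
Qed.

Lemma sort_ord (hm : (0 < m)%N) (ord := nats (run sort_prog start) cord) :
  ord 0 = n /\ forall j, (j < n)%N -> ord (rank n tl tr j).+1 = j.
Proof.
apply: (@run_ord (run nat_prog start)) => [|k|k]; try by rewrite nums_run.
rewrite nats_run ?eqn_add2l //=; last by rewrite !eqn_add2l.
by rewrite /update /= !eqn_add2l /= (_ : (m + 0 == 0)%N = false) //; lia.
Qed.

Lemma run_main (hm : (0 < m)%N) :
  (forall j, cost I j = 1) ->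
  exists2 S : 'I_m -> {set 'I_n}, outputs (run main_prog start) S & optimal I S.
Proof.
move=> c1; have eS := env_sort hm; have [o0 oR] := sort_ord hm.
set ord := nats _ cord in eS o0 oR.
exists (part I (greedy m n (battery I) (follows I ord) (gain I ord))); last first.
  exact: greedy_optimal.
rewrite -[run _ start]/(run walk_prog (run fill_prog (run sort_prog start))).
have [k | eF tF] := run_fill eS _; first by rewrite nums_run.
apply: run_walk => // i j im.
rewrite nats_run; last first.
  rewrite -[nwrites _ _]/[|| i == cx, i == cr | nwrites (nest (m + m) entry_prog) i].
  by apply/negP => /or3P[||/nwrites_nest/orP[/nwrites_entry|]]; lia.
rewrite nats_run; last by rewrite /=; lia.
have hi0 : (i == m + 0)%N = false by lia.
have hi1 : (i == m + 1)%N = false by lia.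
by rewrite /= /update hi0 hi1 /=; case: (_ && _).
Qed.

End Sorting.
End Programs.

Theorem theorem6 (m : nat) (hm : (0 < m)%N) :
  exists (P : com) (q : {poly nat}),
    forall (R : realFieldType) (n : nat) (I : mdsp R n),
      (forall j : 'I_n, cost I j = 1) ->
      exists (t : nat) (M : memory R) (S : 'I_m -> {set 'I_n}),
        [/\ exec P (input I) t M,
            (t <= q.[n])%N,
            outputs M S
          & optimal I S].
Proof.
(* The initialisation writes the loop bounds, so it is not well-formed relative to them; being free
   of loops, it is compiled separately with an empty list of bounds. *)
exists (Seq (compile (init_prog m)) (compile (main_prog m))).
exists (time_poly (init_prog m) + time_poly (main_prog m)) => R n I c1.
have [S oS optS] := run_main hm c1.
have [t1 e1 l1] := @exec_compile R [::] n (init_prog m) (input I) isT (fun _ => ltac:(by [])).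
have [|t2 e2 l2] := @exec_compile R _ n _ (start m I) (wf_main m).
  have [s0 s1] := start_bounds I hm.
  by move=> b; rewrite !inE => /orP[] /eqP->; rewrite ?s0 ?s1.
exists (t1 + t2)%N, (run (main_prog m) (start m I)), S; split=> //.
  exact: ExecSeq e1 e2.
by rewrite hornerD leq_add.
Qed.
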